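(* Let $r_4(\boldsymbol{k})=\prod_{j=1}^d\max(1,|k_j|)$ for $\boldsymbol{k}\in\mathbb{Z}^d$. There exists a constant $C>0$ such that for every $d\in\mathbb{N}$ and every $\varepsilon\in(0,1)$, \[n^{\mathrm{wor}}(\varepsilon,d,F_{d,r_4})\leq C\,\frac{d}{\varepsilon^2}\log\left(1+\frac1\varepsilon\right).\]
   Context: For a weight function $r:\mathbb{Z}^d\to[1,\infty)$, let \[F_{d,r}=\Big\{f\in C([0,1)^d)\ \text{real-valued}:\ \|f\|:=\sum_{\boldsymbol{k}\in\mathbb{Z}^d}|\hat f(\boldsymbol{k})|\,r(\boldsymbol{k})<\infty\Big\},\qquad \hat f(\boldsymbol{k})=\int_{[0,1)^d}f(\boldsymbol{x})e^{-2\pi\mathrm{i}\boldsymbol{k}\cdot\boldsymbol{x}}\,\mathrm{d}\boldsymbol{x}.\] Let $I_d(f)=\int_{[0,1)^d}f$. A linear algorithm using $n$ points is $Q_{d,n}(f)=\sum_{h=0}^{n-1}c_hf(\boldsymbol{x}_h)$ with $\boldsymbol{x}_h\in[0,1)^d$, $c_h\in\mathbb{R}$; $e^{\mathrm{wor}}(F_{d,r},Q_{d,n})=\sup_{\|f\|\leq1}|I_d(f)-Q_{d,n}(f)|$ and $n^{\mathrm{wor}}(\varepsilon,d,F_{d,r})=\min\{n:\exists Q_{d,n},\ e^{\mathrm{wor}}(F_{d,r},Q_{d,n})\leq\varepsilon\}$. $\log$ is the natural logarithm. *)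

(* Defs.v *)
From HB Require Import structures.
From mathcomp Require Import all_boot all_order all_algebra.
From mathcomp Require Import complex.
From mathcomp Require Import all_classical all_reals all_analysis.
Set Implicit Arguments.
Unset Strict Implicit.
Unset Printing Implicit Defensive.
Import Order.TTheory GRing.Theory Num.Theory.
Import numFieldNormedType.Exports.
Local Open Scope classical_set_scope.
Local Open Scope ring_scope.

Section tcons.
Context disp (T : measurableType disp).

Definition tcons d (p : T * d.-tuple T) : d.+1.-tuple T :=
  [tuple of p.1 :: p.2].

Definition tuncons d (t : d.+1.-tuple T) : T * d.-tuple T :=
  (tnth t ord0, [tuple of behead t]).

Lemma tunconsK d : cancel (@tuncons d) (@tcons d).
Proof. by move=> t; rewrite /tcons/= [RHS]tuple_eta; apply/val_inj. Qed.

Lemma tconsK d : cancel (@tcons d) (@tuncons d).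
Proof. by move=> [x t]; rewrite /tuncons/=; congr pair; exact/val_inj. Qed.

Lemma measurable_tcons d : measurable_fun [set: T * d.-tuple T] (@tcons d).
Proof. exact: measurable_cons. Qed.

Lemma measurable_tuncons d : measurable_fun [set: d.+1.-tuple T] (@tuncons d).
Proof.
apply/measurable_fun_pairP; split; first exact: measurable_tnth.
exact: measurable_behead.
Qed.

End tcons.

(* The product measure mu \x nu, carried from T * T^d to T^(d+1). *)
Section product_tuple.
Context disp (T : measurableType disp) (R : realType) (d : nat).
Variable mu : {sigma_finite_measure set T -> \bar R}.
Variable nu : {sigma_finite_measure set (d.-tuple T) -> \bar R}.
Local Open Scope ereal_scope.

Definition product_tuple : set (d.+1.-tuple T) -> \bar R :=
  pushforward (mu \x nu) (@tcons _ T d).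

Let product_tuple0 : product_tuple set0 = 0.
Proof. by rewrite /product_tuple /pushforward preimage_set0 measure0. Qed.

Let product_tuple_ge0 A : 0 <= product_tuple A.
Proof. by rewrite /product_tuple /pushforward measure_ge0. Qed.

Let product_tuple_sigma_additive : semi_sigma_additive product_tuple.
Proof.
move=> F mF tF mUF; rewrite /product_tuple /pushforward preimage_bigcup.
apply: measure_semi_sigma_additive.
- by move=> n; rewrite -[X in measurable X]setTI; exact: measurable_tcons.
- apply/trivIsetP => /= i j _ _ ij; rewrite -preimage_setI.
  by move/trivIsetP : tF => /(_ _ _ _ _ ij) ->//; rewrite preimage_set0.
- rewrite -preimage_bigcup -[X in measurable X]setTI.
  exact: measurable_tcons.
Qed.

HB.instance Definition _ := isMeasure.Build _ _ _ product_tuple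
  product_tuple0 product_tuple_ge0 product_tuple_sigma_additive.

Let product_tuple_sigma_finite : sigma_finite setT product_tuple.
Proof.
have /sigma_finiteP[F [FT ndF Foo]] := sigma_finiteT mu.
have /sigma_finiteP[G [GT ndG Goo]] := sigma_finiteT nu.
exists (fun i => @tuncons _ T d @^-1` (F i `*` G i)) => [|i].
  rewrite -preimage_bigcup -[LHS](preimage_setT (@tuncons _ T d)).
  congr (_ @^-1` _); rewrite -setXTT FT GT; apply/seteqP; split => -[x y].
    move=> [/= [n _ Fnx] [k _ Gky]]; exists (maxn n k) => //; split.
    - by move: x Fnx; exact/subsetPset/ndF/leq_maxl.
    - by move: y Gky; exact/subsetPset/ndG/leq_maxr.
  by move=> [n _ []/= ? ?]; split; exists n.
have [mF Fi] := Foo i; have [mG Gi] := Goo i; split.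
  rewrite -[X in measurable X]setTI.
  by apply: measurable_tuncons => //; exact: measurableX.
rewrite /product_tuple /pushforward -comp_preimage.
have -> : @tuncons _ T d \o @tcons _ T d = id by apply/funext; exact: tconsK.
by rewrite preimage_id product_measure1E// lte_mul_pinfty// ge0_fin_numE.
Qed.

HB.instance Definition _ := Measure_isSigmaFinite.Build _ _ _ product_tuple
  product_tuple_sigma_finite.

End product_tuple.

(* Lebesgue measure on the Borel sets of R^d; on R^0 = {[tuple]} it is the
   point mass. *)
Fixpoint lebesgue_tuple (R : realType) (d : nat) :
    {sigma_finite_measure set (d.-tuple (measurableTypeR R)) -> \bar R} :=
  if d is d'.+1 then [the sigma_finite_measure _ _ of
    product_tuple (@lebesgue_measure R) (lebesgue_tuple R d')]
  else [the sigma_finite_measure _ _ of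
    @dirac _ (0.-tuple (measurableTypeR R)) [tuple] R].

Lemma lebesgue_tuple_box (R : realType) (d : nat)
    (A : 'I_d -> set (measurableTypeR R)) : (forall i, measurable (A i)) ->
  lebesgue_tuple R d [set t | forall i, A i (tnth t i)] =
  (\prod_(i < d) lebesgue_measure (A i))%E.
Proof.
elim: d A => [|d IH] A mA /=.
  rewrite big_ord0 diracE.
  by rewrite mem_set// => -[].
pose B (i : 'I_d) := A (lift ord0 i).
rewrite big_ord_recl /product_tuple /pushforward.
have -> : @tcons _ (measurableTypeR R) d @^-1` [set t | forall i, A i (tnth t i)] =
    A ord0 `*` [set t | forall i, B i (tnth t i)].
  apply/seteqP; split => -[x t]/=.
    move=> h; split=> [|i]; first exact: (h ord0).
    by have := h (lift ord0 i); rewrite tnthS; congr (A _ (tnth _ _)); exact/val_inj.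
  move=> [Ax Bt] i; have [j ->|->//] := unliftP ord0 i.
  by have := Bt j; rewrite tnthS /B; congr (A _ (tnth _ _)); exact/val_inj.
rewrite product_measure1E//; first by rewrite IH// => i; exact: mA.
have -> : [set t : d.-tuple (measurableTypeR R) | forall i, B i (tnth t i)] =
    \bigcap_(i in [set: 'I_d]) ((fun t => tnth t i) @^-1` B i).
  by apply/seteqP; split => t /= h i; [move=> _; exact: h|exact: (h i)].
apply: fin_bigcap_measurable => // i _.
by rewrite -[X in measurable X]setTI; apply: measurable_tnth => //; exact: mA.
Qed.

Section integration_on_the_cube.
Context (R : realType) (d : nat).
Implicit Types (f : 'rV[R]_d -> R) (g : 'rV[R]_d -> R[i]).

Definition cube : set 'rV[R]_d := [set x | forall j, 0 <= x ord0 j < 1].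

(* The library has the topology of R^d on 'rV[R]_d but its Borel sigma-algebra
   on d.-tuple R, whence this identification. *)
Definition row_of_tuple (t : d.-tuple (measurableTypeR R)) : 'rV[R]_d :=
  \row_j tnth t j.

Definition cube_integrable f : Prop :=
  (lebesgue_tuple R d).-integrable (row_of_tuple @^-1` cube)
    (EFin \o (f \o row_of_tuple)).

Definition cube_integral f : R :=
  \int[lebesgue_tuple R d]_(t in row_of_tuple @^-1` cube) f (row_of_tuple t).

Definition cube_cintegral g : R[i] :=
  Complex (cube_integral (fun x => complex.Re (g x)))
          (cube_integral (fun x => complex.Im (g x))).

End integration_on_the_cube.

Section integration_problem.
Context (R : realType) (d : nat).
Implicit Types (f : 'rV[R]_d -> R) (k : 'rV[int]_d) (r : 'rV[int]_d -> R).

(* exp(i t), by Euler's formula *)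
Definition cis (t : R) : R[i] := Complex (cos t) (sin t).

Definition fourier_coef f k : R[i] :=
  cube_cintegral (fun x => Complex (f x) 0 *
    cis (- (2 * pi * \sum_(j < d) (k ord0 j)%:~R * x ord0 j))).

Definition wnorm r f : \bar R :=
  (\esum_(k in [set: 'rV[int]_d])
     (ComplexField.Normc.normc (fourier_coef f k) * r k)%:E)%E.

(* Only the values on the cube matter.  Integrability is what makes the Fourier
   coefficients meaningful (the library's integral is a total function, and a
   continuous function on the half-open cube may be unbounded). *)
Definition F_space r : set ('rV[R]_d -> R) :=
  [set f | [/\ {within @cube R d, continuous f}, cube_integrable f &
               (wnorm r f < +oo)%E]].

Definition linear_algorithm n (c : 'I_n -> R) (x : 'I_n -> 'rV[R]_d) f : R :=
  \sum_(h < n) c h * f (x h).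

Definition e_wor r (Q : ('rV[R]_d -> R) -> R) : \bar R :=
  ereal_sup [set (`|cube_integral f - Q f|)%:E |
             f in [set f | F_space r f /\ (wnorm r f <= 1)%E]].

(* The infimum of a set of natural numbers: its minimum if it is nonempty,
   and +oo otherwise. *)
Definition n_wor (eps : R) r : \bar R :=
  ereal_inf [set (n%:R)%:E | n in
    [set n : nat | exists (c : 'I_n -> R) (x : 'I_n -> 'rV[R]_d),
      (forall h, cube (x h)) /\
      (e_wor r (linear_algorithm c x) <= eps%:E)%E]].

Definition r4 k : R := \prod_(j < d) Num.max 1 `|(k ord0 j)%:~R|.

End integration_problem.

(* Main.v *)
(* Cubature points.  For x uniform on the shifted grid ((a + 1/2) / p)_a with
   p > 2/eps, exp(2 i pi k.x) has mean zero for every nonzero k with all |k_j| < p.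
   Hence points can be chosen one at a time so that the potential
     sum_k r4(k)^-2 exp(eps/8 * (+- sum_h (cos or sin)(2 pi k.x_h)))
   grows by a factor at most 1 + 2 (eps/8)^2 per point.  As sum_k r4(k)^-2 <= 5^d,
   after n >= 224 d / eps^2 points every exponential sum is at most
   n * eps/2 * r4(k); this is trivial for the other frequencies, for which
   r4(k) >= 2/eps.  The logarithmic factor is thus only used through
   ln (1 + 1/eps) >= ln 2.

   From Fourier coefficients to point values.  f is replaced by its convolution
   with the product of the de la Vallee Poussin kernels
   4^N / C(2N, N) cos(pi t)^(2N), whose Fourier coefficients lie in [0, 1].  The
   smoothed f is a trigonometric polynomial, for which the error is at most
   eps * ||f|| by the bound on exponential sums, and it tends to f at interior
   points of the cube.  Unlike Fejer's, these kernels decay exponentially away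
   from 0, which beats the growth (2N+1)^d of their product. *)
Require Import Defs.
From HB Require Import structures.
From mathcomp Require Import all_boot all_order all_algebra.
From mathcomp Require Import complex ring lra zify.
From mathcomp Require Import all_classical all_reals all_analysis.
From mathcomp Require Import measurable_realfun.
Set Implicit Arguments.
Unset Strict Implicit.
Unset Printing Implicit Defensive.
Import Order.TTheory GRing.Theory Num.Theory.
Import numFieldNormedType.Exports.
Local Open Scope classical_set_scope.
Local Open Scope ring_scope.

(** * Choosing points one at a time against an exponential potential *)

Section greedy.
Context {R : realType}.

(** Inverting [1 - x <= expR (- x)] gives [expR x <= (1 - x)^-1]; and
    [(1 - x) * (1 + x + 2 * x ^+ 2)] equals [1 + x ^+ 2 * (1 - 2 * x)], which is at least 1 here. *)
Lemma expR_le_quadratic (x : R) : `|x| <= 2^-1 -> expR x <= 1 + x + 2 * x ^+ 2.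
Proof.
rewrite ler_norml => /andP[x1 x2].
have h : expR x <= (1 - x)^-1.
  rewrite -[expR x]invrK lef_pV2 ?posrE ?invr_gt0 ?expR_gt0//; last lra.
  by rewrite -expRN expR_ge1Dx.
apply: (le_trans h).
rewrite -[_^-1]mul1r ler_pdivrMr; last lra.
have : 0 <= x ^+ 2 * (1 - 2 * x) by apply: mulr_ge0; [exact: sqr_ge0|lra].
nra.
Qed.

(** Averaging over [X] kills the linear term of [expR_le_quadratic], so some point multiplies the
    potential by at most [1 + 2 * l ^+ 2]. *)
Lemma greedy_points (I X : finType) (P : pred I) (w : I -> R)
    (phi : I -> X -> R) (l : R) (n : nat) :
  (0 < #|X|)%N -> 0 <= l <= 2^-1 -> (forall i, 0 <= w i) ->
  (forall i x, `|phi i x| <= 1) -> (forall i, P i -> \sum_x phi i x = 0) ->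
  exists x : 'I_n -> X,
    \sum_(i | P i) w i * expR (l * \sum_h phi i (x h)) <=
    (1 + 2 * l ^+ 2) ^+ n * \sum_(i | P i) w i.
Proof.
move=> X0 /andP[l0 l1]; elim: n w => [|n IH] w w0 phi1 phi0.
  have /card_gt0P[x0 _] := X0.
  exists (fun=> x0); rewrite expr0 mul1r; apply: ler_sum => i _.
  by rewrite big_ord0 mulr0 expR0 mulr1.
have [x Hx] : exists x, \sum_(i | P i) w i * expR (l * phi i x) <=
    (1 + 2 * l ^+ 2) * \sum_(i | P i) w i.
  (* If every point failed, summing the strict inequalities over the nonempty [X] would contradict
     the average. *)
  apply/not_existsP => H.
  have : \sum_(x : X) (1 + 2 * l ^+ 2) * (\sum_(i | P i) w i) <
         \sum_(x : X) \sum_(i | P i) w i * expR (l * phi i x).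
    apply: ltr_sum => [|x _]; last by rewrite ltNge; exact/negP/H.
    apply/hasP; have /card_gt0P[x0 _] := X0; exists x0; rewrite ?(mem_index_enum x0)//.
  rewrite exchange_big/= mulr_sumr exchange_big/= ltNge => /negP; apply.
  apply: ler_sum => i Pi; rewrite -mulr_sumr.
  have -> : \sum_(x : X) (1 + 2 * l ^+ 2) * w i =
      w i * \sum_(x : X) (1 + l * phi i x + 2 * l ^+ 2).
    rewrite !big_split/= -[\sum_j l * _]mulr_sumr phi0// mulr0 addr0.
    by rewrite -big_split/= mulr_sumr; apply: eq_bigr => x _; rewrite mulrC.
  apply: ler_wpM2l => //; apply: ler_sum => x _.
  have h : `|l * phi i x| <= l.
    by rewrite normrM (ger0_norm l0) -[leRHS]mulr1; exact: ler_wpM2l.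
  apply: (le_trans (expR_le_quadratic _)); first exact: le_trans h l1.
  rewrite lerD2l ler_pM2l// -real_normK ?num_real//.
  by rewrite lerXn2r// nnegrE.
(* The factor of the chosen point is absorbed into the weights, which is why the induction runs over
   all [w]. *)
have [|y Hy] := IH (fun i => w i * expR (l * phi i x)) _ phi1 phi0.
  by move=> i; rewrite mulr_ge0// expR_ge0.
exists (fun h => if unlift ord0 h is Some h' then y h' else x).
apply: (@le_trans _ _ ((1 + 2 * l ^+ 2) ^+ n *
    \sum_(i | P i) w i * expR (l * phi i x))).
  apply: le_trans Hy; apply: ler_sum => i _.
  rewrite big_ord_recl unlift_none mulrDr expRD mulrA.
  by rewrite (eq_bigr (fun h => phi i (y h))) // => h _; rewrite liftK.
rewrite (exprSr _ n) -mulrA; apply: ler_wpM2l => //.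
by apply: exprn_ge0; have := sqr_ge0 l; lra.
Qed.

End greedy.

(** * The character [cis] and its periodicity *)

Section cis.
Context {R : realType}.
Implicit Types s t : R.

Lemma cis0 : cis 0 = 1 :> R[i].
Proof. by rewrite /cis cos0 sin0. Qed.

Lemma cisD s t : cis (s + t) = cis s * cis t.
Proof. by rewrite /cis cosD sinD; congr Complex; rewrite addrC. Qed.

Lemma cis_sum (I : Type) (r : seq I) (P : pred I) (F : I -> R) :
  cis (\sum_(i <- r | P i) F i) = \prod_(i <- r | P i) cis (F i).
Proof. exact: (big_morph _ cisD cis0). Qed.

Lemma cisMn t n : cis (t * n%:R) = cis t ^+ n.
Proof.
elim: n => [|n IH]; first by rewrite mulr0 cis0.
by rewrite exprSr -IH -cisD -natr1 mulrDr mulr1.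
Qed.

Lemma cisN2pi (n : nat) : cis (2 * pi * n%:R) = 1 :> R[i].
Proof.
by rewrite cisMn /cis mulr_natl cos2pi sin2pi expr1n.
Qed.

Lemma cosZ2pi (m : int) : cos (2 * pi * m%:~R) = 1 :> R.
Proof.
case: m => n; rewrite ?NegzE ?mulrNz ?mulrN ?cosN.
  by have /(congr1 (@complex.Re R)) := cisN2pi n.
by have /(congr1 (@complex.Re R)) := cisN2pi n.+1.
Qed.

Lemma sinZ2pi (m : int) : sin (2 * pi * m%:~R) = 0 :> R.
Proof.
case: m => n; rewrite ?NegzE ?mulrNz ?mulrN ?sinN.
  by have /(congr1 (@complex.Im R)) := cisN2pi n.
by have /(congr1 (@complex.Im R))/= -> := cisN2pi n.+1; rewrite oppr0.
Qed.

Lemma norm_cos_le1 t : `|cos t| <= 1.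
Proof. by rewrite ler_norml cos_geN1 cos_le1. Qed.

Lemma norm_sin_le1 t : `|sin t| <= 1.
Proof. by rewrite ler_norml sin_geN1 sin_le1. Qed.

(** The double angle formula gives cos^2 - sin^2 at [pi * t], strictly below cos^2 + sin^2 = 1
    because the sine does not vanish. It keeps the ratio of the geometric sums over the grid away
    from 1. *)
Lemma cos2pi_neq1 t : 0 < `|t| < 1 -> cos (2 * pi * t) != 1.
Proof.
move=> t1; wlog t0 : t t1 / 0 <= t.
  move=> H; have [/H->//|t0] := leP 0 t.
  by rewrite -cosN -mulrN H// ?normrN// oppr_ge0 ltW.
move: t1; rewrite ger0_norm// => /andP[t1 t2].
have s0 : 0 < sin (pi * t).
  by apply: sin_gt0_pi; rewrite mulr_gt0 ?pi_gt0//= -[ltRHS]mulr1 ltr_pM2l ?pi_gt0.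
have -> : 2 * pi * t = pi * t + pi * t by ring.
rewrite cosD -!expr2 -(cos2Dsin2 (pi * t)) lt_eqF//.
by have := exprn_gt0 2 s0; lra.
Qed.

End cis.

(** * Mean zero of characters over the shifted grid *)

Section grid.
Context {R : realType} {d : nat}.
Implicit Types (k : 'rV[int]_d) (x : 'rV[R]_d).

Definition phase k x : R := 2 * pi * \sum_(j < d) (k ord0 j)%:~R * x ord0 j.

Lemma cis_phase k x :
  cis (phase k x) = \prod_(j < d) cis (2 * pi * ((k ord0 j)%:~R * x ord0 j)).
Proof. by rewrite /phase mulr_sumr cis_sum. Qed.

(** The shift by 1/2 keeps the points off the faces of the cube, as required by [smoothing_cvg]. *)
Definition gridpt (p : nat) (a : {ffun 'I_d -> 'I_p}) : 'rV[R]_d :=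
  \row_j (((a j)%:R + 2^-1) / p%:R).

Lemma gridpt_itv p (a : {ffun 'I_d -> 'I_p}) j : 0 < gridpt a ord0 j < 1.
Proof.
rewrite mxE; have p0 : (0 < p)%N by case: p a => // a; case: (a j).
rewrite divr_gt0 ?ltr_wpDl ?ltr0n//= ltr_pdivrMr ?ltr0n// mul1r.
have : (a j).+1%:R <= p%:R :> R by rewrite ler_nat.
rewrite -natr1; lra.
Qed.

(** The sum factors over the coordinates. Up to a unit, factor [j] is a geometric sum whose ratio is
    a [p]-th root of unity, different from 1 because [p] does not divide [k ord0 j]. *)
Lemma sum_cis_gridpt p k (j : 'I_d) : (0 < `|k ord0 j| < p)%N ->
  \sum_(a : {ffun 'I_d -> 'I_p}) cis (phase k (gridpt a)) = 0.
Proof.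
move=> /andP[k0 kp].
have p0 : 0 < p%:R :> R by rewrite ltr0n (leq_ltn_trans _ kp).
under eq_bigr do rewrite cis_phase.
pose F (j : 'I_d) (i : 'I_p) : R[i] :=
  cis (2 * pi * ((k ord0 j)%:~R * ((i%:R + 2^-1) / p%:R))).
transitivity (\sum_(a : {ffun 'I_d -> 'I_p}) \prod_(j < d) F j (a j)).
  by apply: eq_bigr => a _; apply: eq_bigr => i _; rewrite mxE.
rewrite -bigA_distr_bigA (bigD1 j)//=.
suff -> : \sum_i F j i = 0 by rewrite mul0r.
pose t : R := (k ord0 j)%:~R / p%:R.
have -> : \sum_i F j i = cis (pi * t) * \sum_(i < p) cis (2 * pi * t) ^+ i.
  rewrite mulr_sumr; apply: eq_bigr => i _; rewrite /F -cisMn -cisD.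
  by congr cis; rewrite /t; field; rewrite gt_eqF.
have t1 : cis (2 * pi * t) - 1 != 0.
  rewrite subr_eq0; apply/eqP => /(congr1 (@complex.Re R))/= /eqP; apply/negP.
  apply: cos2pi_neq1; rewrite /t normrM normfV (ger0_norm (ltW p0)) -intr_norm.
  rewrite divr_gt0 ?ltr0z ?normr_gt0 -?absz_gt0//= ltr_pdivrMr// mul1r.
  by rewrite -abszE -[ltLHS]/(`|k ord0 j|%N%:R) ltr_nat.
have := subrX1 (cis (2 * pi * t)) p.
rewrite -cisMn.
have -> : 2 * pi * t * p%:R = 2 * pi * (k ord0 j)%:~R.
  by rewrite /t; field; rewrite gt_eqF.
rewrite {1}/cis cosZ2pi sinZ2pi subrr => /esym/eqP.
by rewrite mulf_eq0 (negbTE t1)/= => /eqP ->; rewrite mulr0.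
Qed.

Lemma sum_cos_gridpt p k (j : 'I_d) : (0 < `|k ord0 j| < p)%N ->
  \sum_(a : {ffun 'I_d -> 'I_p}) cos (phase k (gridpt a)) = 0.
Proof.
move=> /sum_cis_gridpt/(congr1 (@complex.Re R)).
by rewrite raddf_sum.
Qed.

Lemma sum_sin_gridpt p k (j : 'I_d) : (0 < `|k ord0 j| < p)%N ->
  \sum_(a : {ffun 'I_d -> 'I_p}) sin (phase k (gridpt a)) = 0.
Proof.
move=> /sum_cis_gridpt/(congr1 (@complex.Im R)).
by rewrite raddf_sum.
Qed.

End grid.

(** * The weights [r4] and the summability of their inverse squares *)

Section weights.
Context {R : realType} {d : nat}.
Implicit Types (k : 'rV[int]_d).

Lemma prod_max1_ge1 (P : pred 'I_d) k :
  1 <= \prod_(j < d | P j) Num.max 1 `|(k ord0 j)%:~R| :> R.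
Proof.
apply: (big_ind (fun x : R => 1 <= x)) => // [x y|i _]; first exact: mulr_ege1.
by rewrite le_max lexx.
Qed.

Lemma r4_ge1 k : 1 <= r4 R k.
Proof. exact: prod_max1_ge1. Qed.

Lemma r4_ge_coord k (j : 'I_d) : `|(k ord0 j)%:~R| <= r4 R k.
Proof.
rewrite /r4 (bigD1 j)//= -[leLHS]mulr1; apply: ler_pM => //.
  by rewrite le_max lexx orbT.
exact: prod_max1_ge1.
Qed.

(** Indexes the frequencies of the box [-M, M]^d by a finite function type, so that products of sums
    distribute into sums over the box. *)
Definition boxfreq (M : nat) (a : {ffun 'I_d -> 'I_(2 * M).+1}) : 'rV[int]_d :=
  \row_j ((a j)%:Z - M%:Z).

(** Telescoping: 1/m^2 <= 2/m - 2/(m+1) for m >= 1. *)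
Lemma sum_inv_sq_le (M : nat) :
  \sum_(0 <= i < M) (i.+1%:R ^- 2) <= 2 - 2 / M.+1%:R :> R.
Proof.
elim: M => [|M IH]; first by rewrite big_geq// divr1 subrr.
rewrite big_nat_recr//=; apply: (le_trans (lerD IH (lexx _))).
rewrite -lerBrDl -subr_ge0 -(natr1 M.+1).
have : 0 < M.+1%:R :> R by rewrite ltr0n.
have : 1 <= M.+1%:R :> R by rewrite ler1n.
set m := M.+1%:R => m1 m0.
have -> : 2 - 2 / (m + 1) - (2 - 2 / m) - m ^- 2 = (m - 1) / (m ^+ 2 * (m + 1)).
  by field; apply/andP; split; lra.
by rewrite divr_ge0// ?mulr_ge0 ?exprn_ge0//; lra.
Qed.

(** The sum is the [d]-th power of a one-dimensional sum, which is 1 for the frequency 0 plus at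
    most 2 for each sign. *)
Lemma sum_boxfreq_weight M :
  \sum_(a : {ffun 'I_d -> 'I_(2 * M).+1}) r4 R (boxfreq a) ^- 2 <= 5 ^+ d.
Proof.
pose u (i : nat) : R := Num.max 1 `|(i%:Z - M%:Z)%:~R| ^- 2.
have -> : \sum_(a : {ffun 'I_d -> 'I_(2 * M).+1}) r4 R (boxfreq a) ^- 2 =
   \sum_(a : {ffun 'I_d -> 'I_(2 * M).+1}) \prod_(j < d) u (a j).
  apply: eq_bigr => a _; rewrite /r4 -prodrXl -prodfV; apply: eq_bigr => j _.
  by rewrite mxE.
rewrite -(bigA_distr_bigA (fun (_ : 'I_d) (i : 'I_(2 * M).+1) => u i)) prodr_const card_ord.
have u0 i : 0 <= u i by rewrite invr_ge0 exprn_ge0// le_max ler01.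
rewrite lerXn2r ?nnegrE ?sumr_ge0//.
rewrite -(big_mkord xpredT u) (@big_cat_nat _ _ _ M)//=; last by lia.
have -> : \sum_(0 <= i < M) u i = \sum_(0 <= i < M) (i.+1%:R ^- 2).
  rewrite big_nat_rev/= add0n; apply: eq_big_nat => i /andP[_ iM].
  rewrite /u; congr (_ ^- 2).
  have -> : (M - i.+1)%N%:Z - M%:Z = - i.+1%:Z by lia.
  by rewrite mulrNz normrN -pmulrn normr_nat max_r// ler1n.
have -> : \sum_(M <= i < (2 * M).+1) u i = 1 + \sum_(0 <= i < M) (i.+1%:R ^- 2).
  rewrite -{1}[M]add0n big_addn (_ : ((2 * M).+1 - M = M.+1)%N); last by lia.
  rewrite big_nat_recl//; congr (_ + _).
    by rewrite /u add0n subrr mulr0z normr0 max_l// expr1n invr1.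
  apply: eq_bigr => i _; rewrite /u; congr (_ ^- 2).
  have -> : (i.+1 + M)%N%:Z - M%:Z = i.+1%:Z by lia.
  by rewrite -pmulrn normr_nat max_r// ler1n.
have : 0 <= 2 / M.+1%:R :> R by rewrite divr_ge0.
have := sum_inv_sq_le M.
set S := \sum_(0 <= i < M) _; set T := _ / _.
lra.
Qed.

End weights.

(** * Points with small exponential sums *)

Section qmc_points.
Context {R : realType}.

Lemma qmc_points (d n : nat) (eps : R) : (0 < d)%N -> 0 < eps < 1 ->
  224 * (d%:R / eps ^+ 2) <= n%:R ->
  exists x : 'I_n -> 'rV[R]_d, (forall h j, 0 < x h ord0 j < 1) /\
    forall k : 'rV[int]_d, k != 0 ->
      `|\sum_h cos (phase k (x h))| <= n%:R * (eps / 2 * r4 R k) /\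
      `|\sum_h sin (phase k (x h))| <= n%:R * (eps / 2 * r4 R k).
Proof.
move=> d0 /andP[e0 e1] dn.
have d1 : 1 <= d%:R :> R by rewrite ler1n.
(* A frequency with a coordinate beyond [M] has [eps / 2 * r4 R k >= 1], so the trivial bound [n]
   suffices; the others are covered by the grid with [M.+1] points per axis. *)
pose M := Num.truncn (2 / eps).
have HM : 2 / eps < M.+1%:R by apply: truncnS_gt.
(* The two booleans select a sign and one of [cos] and [sin]: a potential controls only one side, so
   absolute values require both signs. *)
pose I := ({ffun 'I_d -> 'I_(2 * M).+1} * (bool * bool))%type.
pose P (i : I) := @boxfreq d M i.1 != 0.
pose w (i : I) : R := r4 R (boxfreq i.1) ^- 2.
pose phi (i : I) (a : {ffun 'I_d -> 'I_M.+1}) : R :=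
  (-1) ^+ i.2.1 * (if i.2.2 then cos else sin) (phase (boxfreq i.1) (gridpt a)).
have X0 : (0 < #|{ffun 'I_d -> 'I_M.+1}|)%N.
  by rewrite card_ffun !card_ord expn_gt0.
have w0 i : 0 <= w i by rewrite invr_ge0 exprn_ge0// (le_trans ler01)// r4_ge1.
have phi1 i a : `|phi i a| <= 1.
  rewrite /phi normrM normrX normrN1 expr1n mul1r.
  by case: i.2.2; [exact: norm_cos_le1|exact: norm_sin_le1].
have phi0 i : P i -> \sum_a phi i a = 0.
  case: i => a [s c] /rV0Pn[j /= kj0].
  have kj : (0 < `|boxfreq a ord0 j| < M.+1)%N.
    rewrite absz_gt0 kj0/= mxE; have := ltn_ord (a j); lia.
  rewrite -mulr_sumr/=.
  by case: c; rewrite /= ?(sum_cos_gridpt kj) ?(sum_sin_gridpt kj) mulr0.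
(* The value [eps / 8] of [l] maximises [l * (eps / 2) - 2 * l ^+ 2], the exponent gained per point
   when [r4 R k] is 1. *)
have l01 : 0 <= eps / 8 <= 2^-1 by apply/andP; split; lra.
have [y Hy] := greedy_points n X0 l01 w0 phi1 phi0.
exists (fun h => gridpt (y h)); split=> [h j|k k0]; first exact: gridpt_itv.
have r1 := r4_ge1 (R := R) k.
have bnd (g : R -> R) : (forall t, `|g t| <= 1) ->
    `|\sum_h g (phase k (gridpt (y h)))| <= n%:R.
  move=> g1; apply: (le_trans (ler_norm_sum _ _ _)).
  apply: (@le_trans _ _ (\sum_(h < n) 1)); first exact: ler_sum.
  by rewrite sumr_const card_ord.
have [kM|] := boolP [forall j, (`|k ord0 j| <= M)%N]; last first.
  rewrite negb_forall => /existsP[j]; rewrite -ltnNge => kj.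
  have h : 1 <= eps / 2 * r4 R k.
    have := r4_ge_coord (R := R) k j.
    have : M.+1%:R <= `|(k ord0 j)%:~R| :> R.
      by rewrite -intr_norm -abszE -pmulrn ler_nat.
    move: HM; rewrite ltr_pdivrMr//; nra.
  have h' : n%:R <= n%:R * (eps / 2 * r4 R k) by rewrite ler_peMr.
  by split; apply: le_trans h'; apply: bnd; [exact: norm_cos_le1|exact: norm_sin_le1].
move/forallP in kM.
pose a : {ffun 'I_d -> 'I_(2 * M).+1} := [ffun j => inord `|(k ord0 j + M%:Z)%R|%N].
have ak : boxfreq a = k.
  apply/rowP => j; rewrite mxE ffunE -[RHS]/(k ord0 j) inordK; have := kM j; lia.
have signed (s c : bool) :
    (-1) ^+ s * \sum_h (if c then cos else sin) (phase k (gridpt (y h))) <=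
    n%:R * (eps / 2 * r4 R k).
  set S := _ * _.
  have SE : \sum_h phi (a, (s, c)) (y h) = S.
    by rewrite /phi/= ak -mulr_sumr.
  have Pi : P (a, (s, c)) by rewrite /P/= ak.
  (* One term of the potential is at most the whole; its initial value is at most [5 ^+ d] for each
     of the 4 pairs of booleans. *)
  have : w (a, (s, c)) * expR (eps / 8 * S) <=
      expR (n%:R * (2 * (eps / 8) ^+ 2)) * (4 * 5 ^+ d).
    rewrite -SE.
    apply: (@le_trans _ _ (\sum_(i | P i) w i * expR (eps / 8 * \sum_h phi i (y h)))).
      rewrite (bigD1 (a, (s, c)))//= lerDl; apply: sumr_ge0 => i _.
      by rewrite mulr_ge0// expR_ge0.
    apply: (le_trans Hy).
    have q0 : 0 <= 2 * (eps / 8) ^+ 2 by have := sqr_ge0 (eps / 8); lra.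
    apply: ler_pM.
    - by rewrite exprn_ge0//; lra.
    - exact: sumr_ge0.
    - by rewrite expRM_natl lerXn2r ?nnegrE ?expR_ge0 ?expR_ge1Dx//; lra.
    apply: (@le_trans _ _ (\sum_i w i)).
      by rewrite [leRHS](bigID P)/= lerDl; exact: sumr_ge0.
    rewrite -(pair_bigA _ (fun b (_ : bool * bool) => r4 R (boxfreq b) ^- 2))/=.
    under eq_bigr do rewrite sumr_const card_prod card_bool -mulr_natl.
    by rewrite -mulr_sumr ler_pM2l// sum_boxfreq_weight.
  have r0 : 0 < r4 R k by apply: lt_le_trans r1.
  rewrite /w/= ak mulrC ler_pdivrMr ?exprn_gt0// => h.
  (* Everything is put into the exponent by 4 <= e^2, 5 <= e^3 and r <= e^r. *)
  have : expR (eps / 8 * S) <=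
      expR (n%:R * (2 * (eps / 8) ^+ 2) + (2 + d%:R * 3) + 2 * r4 R k).
    apply: (le_trans h); rewrite 2!expRD; apply: ler_pM.
    - by rewrite !mulr_ge0 ?expR_ge0 ?exprn_ge0.
    - by rewrite exprn_ge0// ltW.
    - apply: ler_wpM2l; first exact: expR_ge0.
      have e1' := expR_ge1Dx (1 : R).
      rewrite expRD expRM_natl; apply: ler_pM => //.
        by rewrite (_ : 2 = 1 + 1)// expRD; nra.
      rewrite lerXn2r ?nnegrE ?expR_ge0//.
      rewrite (_ : 3 = 1 + 1 + 1); last ring.
      by rewrite 2!expRD; nra.
    rewrite mulr_natl mulr2n expRD -expr2 lerXn2r ?nnegrE ?expR_ge0 ?(ltW r0)//.
    by apply: le_trans (expR_ge1Dx _); rewrite lerDr.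
  rewrite ler_expR => {}h.
  have : 224 * d%:R <= n%:R * eps ^+ 2.
    by move: dn; rewrite mulrA ler_pdivrMr// exprn_gt0.
  move=> dn'.
  have : 224 * d%:R * r4 R k <= n%:R * eps ^+ 2 * r4 R k by rewrite ler_pM2r.
  have dr : d%:R <= d%:R * r4 R k by rewrite ler_peMr.
  have rr : r4 R k <= d%:R * r4 R k by rewrite ler_peMl// ltW.
  have nr : n%:R * eps ^+ 2 <= n%:R * eps ^+ 2 * r4 R k.
    by rewrite ler_peMr// mulr_ge0// sqr_ge0.
  move=> dnr.
  (* Here 2 + 3d + 2r <= 7dr with r = [r4 R k], and 224 = 7 * 32 makes this at most n eps^2 r / 32;
     the term 2n(eps/8)^2 takes the other half of n eps^2 r / 16. *)
  have : eps / 8 * S <= eps / 8 * (n%:R * (eps / 2 * r4 R k)).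
    apply: (le_trans h); lra.
  by rewrite ler_pM2l//; lra.
have abs c : `|\sum_h (if c then cos else sin) (phase k (gridpt (y h)))| <=
    n%:R * (eps / 2 * r4 R k).
  rewrite ler_norml lerNl; have := signed false c; have := signed true c.
  by rewrite expr0 expr1 mul1r mulN1r => -> ->.
by split; [exact: (abs true)|exact: (abs false)].
Qed.

End qmc_points.

(** * The kernel in one variable *)

Section kernel1.
Context {R : realType}.

(** The row increases up to its middle, is symmetric, and vanishes beyond [2 * N]. *)
Lemma leq_bin_central (N i : nat) : ('C(2 * N, i) <= 'C(2 * N, N))%N.
Proof.
have inc j : (j < N)%N -> ('C(2 * N, j) <= 'C(2 * N, j.+1))%N.
  move=> jN; rewrite -(leq_pmul2l (ltn0Sn j)) mul_bin_left.
  by rewrite leq_mul2r; apply/orP; right; lia.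
have low j : (j <= N)%N -> ('C(2 * N, j) <= 'C(2 * N, N))%N.
  move=> jN; have -> : j = (N - (N - j))%N by lia.
  elim: (N - j)%N => [|m IH]; first by rewrite subn0.
  have [mN|mN] := ltnP m N; last by rewrite (_ : N - m.+1 = N - m)%N//; lia.
  by apply: leq_trans IH; rewrite (_ : N - m = (N - m.+1).+1)%N ?inc//; lia.
have [/low//|Ni] := leqP i N.
have [iN|/bin_small->//] := leqP i (2 * N).
by rewrite -bin_sub// low//; lia.
Qed.

(** The Fourier coefficient of [kernel1 N] at the frequency [i - N]. *)
Definition kcoef N (i : nat) : R := 'C(2 * N, i)%:R / 'C(2 * N, N)%:R.

Lemma bin_central_gt0 N : 0 < 'C(2 * N, N)%:R :> R.
Proof. by rewrite ltr0n bin_gt0; lia. Qed.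

Lemma kcoef_ge0 N i : 0 <= kcoef N i.
Proof. by rewrite divr_ge0. Qed.

Lemma kcoef_le1 N i : kcoef N i <= 1.
Proof. by rewrite ler_pdivrMr ?bin_central_gt0// mul1r ler_nat leq_bin_central. Qed.

Lemma kcoef_central N : kcoef N N = 1.
Proof. by rewrite /kcoef divff// gt_eqF// bin_central_gt0. Qed.

(* Normalised so that its mean is 1; 4^N / C(2N, N) is at most 2N + 1. *)
Definition kernel1 N (t : R) : R :=
  4 ^+ N / 'C(2 * N, N)%:R * cos (pi * t) ^+ (2 * N).

Lemma kernel1_ge0 N t : 0 <= kernel1 N t.
Proof.
rewrite /kernel1 exprM; apply: mulr_ge0; first by rewrite divr_ge0 ?exprn_ge0.
by rewrite exprn_ge0// sqr_ge0.
Qed.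

(** Binomial expansion of the power [2 * N] of [cis (pi * t) + cis (- (pi * t))], whose term [i] has
    phase [2 * pi * (i - N) * t]. *)
Lemma kernel1_cis N t :
  \sum_(i < (2 * N).+1) (kcoef N i)%:C%C * cis (2 * pi * ((i%:Z - N%:Z)%:~R * t)) =
  (kernel1 N t)%:C%C.
Proof.
have cisC s : cis s + cis (- s) = (2 * cos s)%:C%C.
  by rewrite /cis cosN sinN; apply/eqP; rewrite eq_complex/= subrr eqxx andbT mulr_natl mulr2n.
have -> : kernel1 N t = (2 * cos (pi * t)) ^+ (2 * N) / 'C(2 * N, N)%:R.
  by rewrite /kernel1 (_ : 4 = 2 ^+ 2); [rewrite -exprM exprMn mulrAC|ring].
rewrite rmorphM rmorphXn/= -cisC addrC exprDn mulr_suml.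
apply: eq_bigr => i _.
rewrite -!cisMn -cisD -[_ *+ 'C(_, i)]mulr_natl [RHS]mulrAC /kcoef rmorphM/= rmorph_nat.
congr (_ * cis _).
have iN : (i <= 2 * N)%N by rewrite -ltnS.
rewrite natrB// natrM rmorphB/= -!pmulrn; ring.
Qed.

Lemma kernel1_cos N t : kernel1 N t =
  \sum_(i < (2 * N).+1) kcoef N i * cos (2 * pi * ((i%:Z - N%:Z)%:~R * t)).
Proof.
have /(congr1 (@complex.Re R))/= <- := kernel1_cis N t.
by rewrite raddf_sum; apply: eq_bigr => i _ /=; rewrite mul0r subr0.
Qed.

Lemma kernel1_le N (t q : R) : cos (pi * t) ^+ 2 <= q ->
  kernel1 N t <= (2 * N).+1%:R * q ^+ N.
Proof.
move=> tq; rewrite /kernel1 exprM; apply: ler_pM.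
- by rewrite divr_ge0 ?exprn_ge0.
- by rewrite exprn_ge0// sqr_ge0.
- rewrite ler_pdivrMr ?bin_central_gt0//.
  rewrite -!natrX -natrM ler_nat.
  (* Row [2 * N] of Pascal's triangle has [2 * N + 1] entries, of sum [4 ^ N], none above the
     central one. *)
  have -> : (4 ^ N = \sum_(i < (2 * N).+1) 'C(2 * N, i))%N.
    have := expnDn 1 1 (2 * N); rewrite addn1 expnM => ->.
    by apply: eq_bigr => i _; rewrite !exp1n !muln1.
  apply: (@leq_trans (\sum_(i < (2 * N).+1) 'C(2 * N, N))).
    by apply: leq_sum => i _; exact: leq_bin_central.
  by rewrite sum_nat_const card_ord.
- by rewrite lerXn2r// nnegrE ?sqr_ge0// (le_trans (sqr_ge0 _) tq).
Qed.

End kernel1.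

(** * The mean of the kernel in one variable *)

Section kernel1_integral.
Context {R : realType}.
Notation mu := (@lebesgue_measure R).

Lemma is_derive_sin_affine (a b y : R) : a != 0 ->
  is_derive y (1 : R) (fun y : R => a^-1 * sin (a * y + b)) (cos (a * y + b)).
Proof.
move=> a0.
have H : is_derive y (1 : R) (fun y : R => a * y + b) a.
  by apply: is_derive_eq; rewrite addr0 /GRing.scale/= mulr1.
have := is_derive1_comp (f := sin) (g := fun y : R => a * y + b) (x := y).
move=> /(_ _ _ (is_derive_sin _) H) H'.
have := is_deriveZ a^-1 H'.
by rewrite /GRing.scale/= mulrCA mulVf// mulr1.
Qed.

Lemma continuous_cos_affine (a b : R) : continuous (fun y : R => cos (a * y + b)).
Proof.
move=> y; apply: (@continuous_comp _ _ _ (fun y : R => a * y + b) (@cos R)).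
  apply: cvgD; last exact: cvg_cst.
  by apply: cvgM; [exact: cvg_cst|exact: cvg_id].
exact: continuous_cos.
Qed.

Lemma integral_cos_affine (a b : R) : a != 0 ->
  (\int[mu]_(y in `[0%R, 1%R]) (cos (a * y + b))%:E =
   (a^-1 * sin (a + b) - a^-1 * sin b)%:E)%E.
Proof.
move=> a0.
rewrite (@continuous_FTC2 R (fun y => cos (a * y + b)) (fun y => a^-1 * sin (a * y + b))) ?ltr01//.
- by rewrite mulr1 mulr0 add0r.
- by apply: continuous_subspaceT; exact: continuous_cos_affine.
- have dF y := @is_derive_sin_affine a b y a0.
  have cF y : {for y, continuous (fun y : R => a^-1 * sin (a * y + b))}.
    by apply: differentiable_continuous; apply/derivable1_diffP; have [] := dF y.
  split => [y _||]; first by have [] := dF y.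
    by apply: cvg_at_right_filter; exact: cF.
  by apply: cvg_at_left_filter; exact: cF.
- by move=> y _; rewrite derive1E; have [_ ->] := is_derive_sin_affine b y a0.
Qed.

(** For nonzero [m] the antiderivative takes the same value at both ends of a whole number of
    periods. *)
Lemma integral_cos_freq (m : int) (s : R) :
  (\int[mu]_(y in `[0%R, 1%R]) (cos (2 * pi * (m%:~R * (s - y))))%:E =
   (m == 0)%:R%:E)%E.
Proof.
have [->|m0] := eqVneq m 0.
  under eq_integral do rewrite mulr0z mul0r mulr0 cos0.
  by rewrite integral_cst//= lebesgue_measure_itv/= lte01 oppr0 adde0 mule1 mulr1n.
have a0 : - (2 * pi * m%:~R) != 0 :> R.
  by rewrite oppr_eq0 !mulf_eq0 pnatr_eq0 intr_eq0 (negbTE m0) orbF (gt_eqF (pi_gt0 R)).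
under eq_integral.
  move=> y _.
  rewrite (_ : 2 * pi * _ = - (2 * pi * m%:~R) * y + 2 * pi * m%:~R * s); last by ring.
  over.
rewrite integral_cos_affine//; congr EFin.
by rewrite sinD (cosN (2 * pi * _)) (sinN (2 * pi * _)) cosZ2pi sinZ2pi oppr0 mul0r add0r mul1r subrr.
Qed.

Lemma measurable_cos_freq (m : int) (s : R) (A : set R) :
  measurable_fun A (fun y : R => cos (2 * pi * (m%:~R * (s - y)))).
Proof.
apply: measurable_funTS; apply: continuous_measurable_fun.
rewrite (_ : (fun y => _) =
  (fun y : R => cos (- (2 * pi * m%:~R) * y + 2 * pi * m%:~R * s))).
  exact: continuous_cos_affine.
by apply/funext => y; congr cos; ring.
Qed.

Lemma measurable_kernel1 N (s : R) (A : set R) :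
  measurable_fun A (fun y : R => kernel1 N (s - y)).
Proof.
rewrite (_ : (fun y => _) = (fun y : R => \sum_(i < (2 * N).+1) kcoef N i *
    cos (2 * pi * ((i%:Z - N%:Z)%:~R * (s - y))))).
  apply: measurable_sum => i; apply: measurable_funM; first exact: measurable_cst.
  exact: measurable_cos_freq.
by apply/funext => y; rewrite kernel1_cos.
Qed.

(** Only the frequency 0, at index [N], survives integration, and [kcoef N N] is 1. *)
Lemma integral_kernel1 N (s : R) :
  (\int[mu]_(y in `[0%R, 1%R[) (kernel1 N (s - y))%:E = 1)%E.
Proof.
rewrite integral_itv_bndo_bndc; last first.
  by apply/measurable_EFinP; exact: measurable_kernel1.
under eq_integral do rewrite kernel1_cos -sumEFin.
have icos (i : 'I_(2 * N).+1) : mu.-integrable (`[0, 1]%classic : set R)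
    (EFin \o (fun y : R => cos (2 * pi * ((i%:Z - N%:Z)%:~R * (s - y))))).
  apply: measurable_bounded_integrable => //.
  - by have := @lebesgue_measure_itv R `[0, 1]; rewrite /= lte01 => ->; rewrite -EFinB ltry.
  - exact: measurable_cos_freq.
  - exists 1; split => // M M1 y _ /=; apply: le_trans (ltW M1).
    exact: norm_cos_le1.
rewrite integral_sum//; last first.
  move=> i; exact: (integrableZl _ _ (icos i)).
have NN : (N < (2 * N).+1)%N by lia.
rewrite (bigD1 (Ordinal NN))//= big1 ?adde0 => [|i iN].
  under eq_integral do rewrite EFinM.
  rewrite integralZl//; last exact: (icos (Ordinal NN)).
  by rewrite integral_cos_freq subrr eqxx kcoef_central mule1.
under eq_integral do rewrite EFinM.
rewrite integralZl//; last exact: icos.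
rewrite integral_cos_freq subr_eq0 eqz_nat -[X in X == _]/(val i).
by rewrite (negbTE (_ : val i != N)) ?mule0.
Qed.

End kernel1_integral.

(** * Integrals of products over the cube *)

Section cube_measure.
Context {R : realType}.
Notation mu := (@lebesgue_measure R).

Lemma measurable_prod_tnth d (g : 'I_d -> R -> R) :
  (forall i, measurable_fun [set: R] (g i)) ->
  measurable_fun [set: d.-tuple (measurableTypeR R)]
    (fun t => \prod_(i < d) g i (tnth t i)).
Proof.
move=> mg; apply: measurable_prod => i _.
exact: (measurableT_comp (mg i) (measurable_tnth i)).
Qed.

(** Induction on [d]: the measure is a pushforward of a product measure, and Tonelli's theorem
    splits off the first coordinate. *)
Lemma integral_prod_tnth d (g : 'I_d -> R -> R) :
  (forall i, measurable_fun [set: R] (g i)) -> (forall i y, 0 <= g i y) ->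
  (\int[lebesgue_tuple R d]_t (\prod_(i < d) g i (tnth t i))%:E =
   \prod_(i < d) \int[mu]_y (g i y)%:E)%E.
Proof.
elim: d g => [|d IH] g mg g0.
  rewrite big_ord0 /=; under eq_integral do rewrite big_ord0.
  by rewrite integral_dirac//= diracT mul1e.
pose G (t : d.-tuple (measurableTypeR R)) := \prod_(i < d) g (lift ord0 i) (tnth t i).
have mG : measurable_fun setT G.
  exact: (@measurable_prod_tnth d (fun i => g (lift ord0 i)) (fun i => mg _)).
have G0 t : 0 <= G t by apply: prodr_ge0.
transitivity (\int[mu \x lebesgue_tuple R d]_p (g ord0 p.1 * G p.2)%:E)%E.
  have := @ge0_integral_pushforward _ _ _ _ R _ (@measurable_tcons _ _ d)
    (mu \x lebesgue_tuple R d)%E setT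
    (fun t => (\prod_(i < d.+1) g i (tnth t i))%:E) measurableT.
  move=> /= ->; last 2 first.
  - by apply/measurable_EFinP; exact: measurable_prod_tnth.
  - by move=> t _; rewrite lee_fin prodr_ge0.
  rewrite preimage_setT; apply: eq_integral => -[x t] _ /=.
  rewrite big_ord_recl; congr (_ * _)%:E.
  by apply: eq_bigr => i _; rewrite tnthS; congr (g _ (tnth _ _)); exact/val_inj.
rewrite fubini_tonelli1/=; last 2 first.
- apply/measurable_EFinP; apply: measurable_funM.
    exact: (measurableT_comp (mg ord0) measurable_fst).
  exact: (measurableT_comp mG measurable_snd).
- by move=> p; rewrite lee_fin mulr_ge0.
rewrite big_ord_recl -IH//.
have IG0 : (0 <= \int[lebesgue_tuple R d]_t (G t)%:E)%E.
  by apply: integral_ge0 => t _; rewrite lee_fin.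
rewrite -ge0_integralZr//; last 2 first.
- exact: (measurableT_comp (@EFin_measurable R setT) (mg ord0)).
- by move=> y _; rewrite lee_fin.
apply: eq_integral => x _; rewrite /fubini_F/=.
under eq_integral do rewrite EFinM.
rewrite ge0_integralZl//.
- exact/measurable_EFinP.
- by move=> t _; rewrite lee_fin.
- by rewrite lee_fin.
Qed.

Definition tcube d : set (d.-tuple (measurableTypeR R)) :=
  @row_of_tuple R d @^-1` @cube R d.
Arguments tcube : clear implicits.

Lemma tcubeE d : tcube d = [set t | forall i, `[0, 1[%classic (tnth t i)].
Proof.
by apply/seteqP; split=> t /= h j; have := h j; rewrite /row_of_tuple/= mxE in_itv.
Qed.

Lemma measurable_tcube d : measurable (tcube d).
Proof.
rewrite tcubeE.
have -> : [set t : d.-tuple (measurableTypeR R) | forall i, `[0, 1[%classic (tnth t i)] =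
    \bigcap_(i in [set: 'I_d]) ((fun t => tnth t i) @^-1` `[0, 1[%classic).
  by apply/seteqP; split => t /= h i; [move=> _; exact: h|exact: (h i)].
apply: fin_bigcap_measurable => // i _.
by rewrite -[X in measurable X]setTI; apply: measurable_tnth.
Qed.

Lemma lebesgue_tcube d : lebesgue_tuple R d (tcube d) = 1%E.
Proof.
rewrite tcubeE (@lebesgue_tuple_box R d (fun=> `[0, 1[%classic))//.
rewrite big1// => i _; have := @lebesgue_measure_itv R `[0, 1[.
by rewrite /= lte01 oppr0 adde0.
Qed.

Lemma integral_tcube_prod d (g : 'I_d -> R -> R) :
  (forall i, measurable_fun [set: R] (g i)) -> (forall i y, 0 <= g i y) ->
  (\int[lebesgue_tuple R d]_(t in tcube d) (\prod_(i < d) g i (tnth t i))%:E =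
   \prod_(i < d) \int[mu]_(y in `[0%R, 1%R[) (g i y)%:E)%E.
Proof.
move=> mg g0.
(* The indicator of the cube is a product of indicators, one of which goes into each factor. *)
pose h i y := g i y * \1_(`[0, 1[%classic : set R) y.
have mh i : measurable_fun [set: R] (h i).
  by apply: measurable_funM => //; exact: measurable_indic.
have h0 i y : 0 <= h i y by rewrite mulr_ge0.
rewrite integral_mkcond; transitivity
  (\int[lebesgue_tuple R d]_t (\prod_(i < d) h i (tnth t i))%:E)%E.
  apply: eq_integral => t _; rewrite patchE big_split/=.
  rewrite tcubeE; case: ifPn => [/set_mem/= ht|].
    rewrite [X in (_ * X)%:E]big1 ?mulr1// => i _.
    by rewrite indicE mem_set//; exact: ht.
  rewrite notin_setE/= => /existsNP[i hi].
  by rewrite [X in (_ * X)%:E](bigD1 i)//= indicE memNset// mul0r mulr0.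
rewrite integral_prod_tnth//; apply: eq_bigr => i _.
rewrite [RHS]integral_mkcond; apply: eq_integral => y _.
by rewrite patchE /h indicE; case: ifPn => _; rewrite ?mulr1 ?mulr0.
Qed.

End cube_measure.

Arguments tcube : clear implicits.

(** * The product kernel and the smoothed function *)

Section kernel.
Context {R : realType} {d : nat}.
Notation mu := (lebesgue_tuple R d).
Notation D := (tcube R d).
Notation row := (@row_of_tuple R d).
Implicit Types (k : 'rV[int]_d) (x y z : 'rV[R]_d) (f : 'rV[R]_d -> R).

Definition kernel N z : R := \prod_(j < d) kernel1 N (z ord0 j).

Lemma kernel_ge0 N z : 0 <= kernel N z.
Proof. by apply: prodr_ge0 => j _; exact: kernel1_ge0. Qed.

Lemma phaseB k x y : phase k (x - y) = phase k x - phase k y.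
Proof.
rewrite /phase -mulrBr -sumrB; congr (_ * _); apply: eq_bigr => j _.
by rewrite !mxE mulrBr.
Qed.

(** The product of the expansions [kernel1_cis] is distributed over the box, where characters
    multiply; real parts are taken last. *)
Lemma kernel_cos N z : kernel N z =
  \sum_(a : {ffun 'I_d -> 'I_(2 * N).+1})
    (\prod_(j < d) kcoef N (a j)) * cos (phase (boxfreq a) z).
Proof.
have H : (kernel N z)%:C%C = \sum_(a : {ffun 'I_d -> 'I_(2 * N).+1})
    (\prod_(j < d) kcoef N (a j))%:C%C * cis (phase (boxfreq a) z).
  rewrite /kernel rmorph_prod.
  under eq_bigr do rewrite /= -kernel1_cis.
  rewrite bigA_distr_bigA; apply: eq_bigr => a _.
  rewrite big_split/= -rmorph_prod cis_phase; congr (_ * _).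
  by apply: eq_bigr => j _; rewrite mxE.
have /(congr1 (@complex.Re R))/= -> := H.
by rewrite raddf_sum; apply: eq_bigr => a _ /=; rewrite mul0r subr0.
Qed.

Lemma measurable_phase k :
  measurable_fun [set: d.-tuple (measurableTypeR R)] (fun t => phase k (row t)).
Proof.
apply: measurable_funM; first exact: measurable_cst.
apply: measurable_sum => j; apply: measurable_funM; first exact: measurable_cst.
rewrite (_ : (fun t => _) = (fun t => tnth t j)); first exact: measurable_tnth.
by apply/funext => t; rewrite mxE.
Qed.

(** Stated for any bounded continuous [g] so as to cover the translated cosine in
    [smoothing_integrand] besides [cos] and [sin]. *)
Lemma integrable_mul_phase (g : R -> R) f k :
  continuous g -> (forall s, `|g s| <= 1) -> cube_integrable f ->
  mu.-integrable D (EFin \o (fun t => f (row t) * g (phase k (row t)))).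
Proof.
move=> cg g1 intf.
rewrite (_ : EFin \o _ = ((EFin \o (fun t => g (phase k (row t)))) \*
  (EFin \o (f \o row)))%E); last by apply/funext => t /=; rewrite mulrC.
apply: integrableMr => //; first exact: measurable_tcube.
  apply: measurable_funTS.
  exact: measurableT_comp (continuous_measurable_fun cg) (measurable_phase k).
by exists 1; split => // M M1 t _ /=; apply: le_trans (ltW M1).
Qed.

Definition integrable_cos f k :=
  @integrable_mul_phase cos f k (@continuous_cos R) norm_cos_le1.
Definition integrable_sin f k :=
  @integrable_mul_phase sin f k (@continuous_sin R) norm_sin_le1.

Definition fcos f k : R := \int[mu]_(t in D) (f (row t) * cos (phase k (row t))).
Definition fsin f k : R := \int[mu]_(t in D) (f (row t) * sin (phase k (row t))).

Lemma fourier_coefE f k : cube_integrable f ->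
  fourier_coef f k = Complex (fcos f k) (- fsin f k).
Proof.
move=> intf; rewrite /fourier_coef /cube_cintegral; congr Complex.
  apply: eq_Rintegral => t _ /=.
  by rewrite mul0r subr0 cosN.
rewrite /fsin -mulN1r -RintegralZl; last 2 first.
- exact: measurable_tcube.
- exact: integrable_sin.
by apply: eq_Rintegral => t _ /=; rewrite mul0r addr0 sinN mulN1r mulrN.
Qed.

Lemma fcos_le f k : cube_integrable f ->
  `|fcos f k| <= ComplexField.Normc.normc (fourier_coef f k).
Proof.
move=> intf; rewrite fourier_coefE//= -sqrtr_sqr ler_sqrt ?addr_ge0 ?sqr_ge0//.
by rewrite lerDl sqr_ge0.
Qed.

Lemma fsin_le f k : cube_integrable f ->
  `|fsin f k| <= ComplexField.Normc.normc (fourier_coef f k).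
Proof.
move=> intf; rewrite fourier_coefE//= -sqrtr_sqr ler_sqrt ?addr_ge0 ?sqr_ge0//.
by rewrite sqrrN lerDr sqr_ge0.
Qed.

Lemma Rintegral_sum (I : Type) (s : seq I) (F : I -> d.-tuple (measurableTypeR R) -> R) :
  (forall i, mu.-integrable D (EFin \o F i)) ->
  \int[mu]_(t in D) (\sum_(i <- s) F i t) = \sum_(i <- s) \int[mu]_(t in D) F i t.
Proof.
move=> iF; rewrite /Rintegral.
under eq_integral do rewrite -sumEFin.
rewrite integral_sum//; last exact: measurable_tcube.
rewrite (eq_bigr (fun i => (fine (\int[mu]_(t in D) (F i t)%:E))%:E)%E).
  by rewrite sumEFin.
move=> i _; rewrite fineK//.
exact: (@integrable_fin_num _ _ _ _ _ (@measurable_tcube R d) (EFin \o F i) (iF i)).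
Qed.

(** A convolution on the torus, since [kernel1] has period 1. *)
Definition smoothing N f x : R := \int[mu]_(t in D) (f (row t) * kernel N (x - row t)).

Lemma smoothing_integrand f k x : cube_integrable f ->
  mu.-integrable D (EFin \o (fun t => f (row t) * cos (phase k (x - row t)))).
Proof.
move=> intf.
rewrite (_ : (fun t => _) =
    (fun t => f (row t) * (fun s => cos (phase k x - s)) (phase k (row t)))).
  apply: (@integrable_mul_phase (fun s => cos (phase k x - s))) => //.
    move=> s; apply: (@continuous_comp _ _ _ (fun s => phase k x - s) (@cos R)).
      by apply: cvgB; [exact: cvg_cst|exact: cvg_id].
    exact: continuous_cos.
  by move=> s; exact: norm_cos_le1.
by apply/funext => t; rewrite phaseB.
Qed.

Lemma smoothingE N f x : cube_integrable f -> smoothing N f x =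
  \sum_(a : {ffun 'I_d -> 'I_(2 * N).+1}) (\prod_(j < d) kcoef N (a j)) *
    (fcos f (boxfreq a) * cos (phase (boxfreq a) x) +
     fsin f (boxfreq a) * sin (phase (boxfreq a) x)).
Proof.
move=> intf; rewrite /smoothing.
have mD := @measurable_tcube R d.
under eq_Rintegral do rewrite kernel_cos mulr_sumr.
rewrite Rintegral_sum => [|a].
  apply: eq_bigr => a _; under eq_Rintegral do rewrite mulrCA.
  rewrite RintegralZl//; last exact: smoothing_integrand.
  congr (_ * _); have ic := integrable_cos (boxfreq a) intf.
  have isn := integrable_sin (boxfreq a) intf.
  rewrite mulrC [X in _ + X]mulrC /fcos /fsin -!RintegralZl// -RintegralD//.
  - by apply: eq_Rintegral => t _; rewrite phaseB cosB mulrDr; congr (_ + _); ring.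
  - exact: (integrableZl mD _ ic).
  - exact: (integrableZl mD _ isn).
rewrite (_ : EFin \o _ = (fun t => (\prod_(j < d) kcoef N (a j))%:E *
    (EFin \o (fun t => f (row t) * cos (phase (boxfreq a) (x - row t)))%R) t)%E).
  exact: (integrableZl mD _ (smoothing_integrand (boxfreq a) x intf)).
by apply/funext => t /=; rewrite -EFinM mulrCA.
Qed.

Lemma integral_kernel N x :
  (\int[mu]_(t in D) (kernel N (x - row t)%R)%:E = 1)%E.
Proof.
transitivity (\int[mu]_(t in D)
    (\prod_(j < d) kernel1 N (x ord0 j - tnth t j)%R)%R%:E)%E.
  apply: eq_integral => t _; congr EFin; apply: eq_bigr => j _.
  by rewrite !mxE.
rewrite (@integral_tcube_prod R d (fun j (s : R) => kernel1 N (x ord0 j - s))).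
- by rewrite big1// => j _; exact: integral_kernel1.
- by move=> j; exact: measurable_kernel1.
- by move=> j y; exact: kernel1_ge0.
Qed.

Lemma boxfreq_inj M : injective (@boxfreq d M).
Proof.
move=> a b /rowP ab; apply/ffunP => j; apply/val_inj.
by have := ab j; rewrite !mxE => /addIr [].
Qed.

(** Distinct indices give distinct frequencies, so the left side is one of the finite sums whose
    supremum is [wnorm]. *)
Lemma sum_boxfreq_wnorm (r : 'rV[int]_d -> R) f M : (forall k, 0 <= r k) ->
  ((\sum_(a : {ffun 'I_d -> 'I_(2 * M).+1})
     ComplexField.Normc.normc (fourier_coef f (boxfreq a)) * r (boxfreq a))%:E <=
   wnorm r f)%E.
Proof.
move=> r0; apply: esum_ge; exists (range (@boxfreq d M)).
  by split => //; exact/finite_image/finite_finset.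
rewrite fsbig_image; last by move=> a b _ _; exact: boxfreq_inj.
rewrite -sumEFin [leLHS]fsbig_seq ?index_enum_uniq//.
rewrite (_ : [set` index_enum _] = setT)//.
by apply/seteqP; split => // a _ /=; exact: mem_index_enum.
Qed.

End kernel.

(** * Pointwise convergence of the smoothed function *)

Section convergence.
Context {R : realType} {d : nat}.
Notation mu := (lebesgue_tuple R d).
Notation D := (tcube R d).
Notation row := (@row_of_tuple R d).
Implicit Types (x y z : 'rV[R]_d) (f : 'rV[R]_d -> R).

(** The hypothesis keeps [t] at distance at least [dl] from the integers, so [cos (pi * t)] lies
    between [cos (pi * (1 - dl))], that is [- cos (pi * dl)], and [cos (pi * dl)]. *)
Lemma cos_sqr_le (dl t : R) : 0 <= dl -> dl <= `|t| <= 1 - dl ->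
  cos (pi * t) ^+ 2 <= cos (pi * dl) ^+ 2.
Proof.
move=> d0; wlog t0 : t / 0 <= t.
  move=> H; have [/H//|t0] := leP 0 t.
  by rewrite -normrN -cosN -mulrN; apply: H; rewrite oppr_ge0 ltW.
rewrite ger0_norm// => /andP[t1 t2].
have p0 := pi_gt0 R.
have lecos (u v : R) : 0 <= u -> v <= 1 -> u <= v -> cos (pi * v) <= cos (pi * u).
  move=> u0 v1 uv; rewrite leNgt ltr_cos -?leNgt ?ler_pM2l//.
    by rewrite in_itv/=; apply/andP; split; nra.
  by rewrite in_itv/=; apply/andP; split; nra.
have h1 : cos (pi * t) <= cos (pi * dl) by apply: lecos; lra.
have h2 : - cos (pi * dl) <= cos (pi * t).
  rewrite -cosDpi -cosN (_ : - (pi * dl + pi) = pi * (1 - dl) - pi *+ 2);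
    last by rewrite mulr2n; ring.
  by rewrite -(cosD2pi (_ - _)) subrK; apply: lecos; lra.
nra.
Qed.

Lemma cos_sqr_lt1 (dl : R) : 0 < dl < 1 -> cos (pi * dl) ^+ 2 < 1.
Proof.
move=> /andP[d0 d1]; have s0 : 0 < sin (pi * dl).
  by apply: sin_gt0_pi; rewrite mulr_gt0 ?pi_gt0//= -[ltRHS]mulr1 ltr_pM2l ?pi_gt0.
by rewrite -(cos2Dsin2 (pi * dl)); have := exprn_gt0 2 s0; lra.
Qed.

(** Coordinate [j] supplies the decay; every other factor is bounded only by [2 * N + 1]. *)
Lemma kernel_le N (j : 'I_d) (z : 'rV[R]_d) (q : R) :
  cos (pi * z ord0 j) ^+ 2 <= q ->
  kernel N z <= (2 * N).+1%:R ^+ d * q ^+ N.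
Proof.
move=> zq; apply: (@le_trans _ _
    (\prod_(i < d) ((2 * N).+1%:R * (if i == j then q ^+ N else 1)))).
  apply: ler_prod => i _; rewrite kernel1_ge0/=.
  have [->|_] := eqVneq i j; first exact: kernel1_le.
  have := @kernel1_le R N (z ord0 i) 1; rewrite expr1n; apply.
  have := sqr_ge0 (sin (pi * z ord0 i)); have := cos2Dsin2 (pi * z ord0 i); lra.
rewrite big_split/= prodr_const card_ord (bigD1 j)//= eqxx big1 ?mulr1// => i ij.
by rewrite (negbTE ij).
Qed.

(* The degrees N = d * 2L make N-th powers d-th powers, which reduces the claim
   to L * q^(2L) -> 0. *)
Lemma kernel_tail_small (q e : R) : (0 < d)%N -> 0 <= q < 1 -> 0 < e ->
  \forall L \near \oo,
    (2 * (d * (2 * L))).+1%:R ^+ d * q ^+ (d * (2 * L)) <= e.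
Proof.
move=> d0 /andP[q0 q1] e0.
pose c : R := (4 * d)%:R / (1 - q).
have c0 : 0 < c by rewrite divr_gt0 ?subr_gt0 ?ltr0n ?muln_gt0.
(* The minimum with 1 ensures that the base of the [d]-th power is at most 1, so that the power is
   at most its base. *)
have m0 : 0 < Num.min 1 e / c by rewrite divr_gt0// lt_min ltr01.
have : (GRing.exp q : nat -> R) @ \oo --> (0 : R) by apply: cvg_expr; rewrite ger0_norm.
move/cvgrPdist_le => /(_ _ m0); apply: filterS => L.
rewrite sub0r normrN ger0_norm ?exprn_ge0// ler_pdivlMr// le_min => /andP[h1 he].
have -> : q ^+ (d * (2 * L)) = (q ^+ (2 * L)) ^+ d by rewrite -exprM mulnC.
rewrite -exprMn.
have qL : L.+1%:R * q ^+ L <= (1 - q)^-1.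
  rewrite -[leRHS]mul1r ler_pdivlMr ?subr_gt0//.
  have := subrX1 q L.+1.
  have : L.+1%:R * q ^+ L <= \sum_(i < L.+1) q ^+ i.
    have -> : L.+1%:R * q ^+ L = \sum_(i < L.+1) q ^+ L.
      by rewrite sumr_const card_ord mulr_natl.
    apply: ler_sum => i _; apply: ler_wiXn2l => //; first exact: ltW.
    by rewrite -ltnS.
  have := exprn_ge0 L.+1 q0; nra.
have h : (2 * (d * (2 * L))).+1%:R * q ^+ (2 * L) <= q ^+ L * c.
  have -> : q ^+ (2 * L) = q ^+ L * q ^+ L by rewrite mul2n -addnn exprD.
  rewrite mulrA [leLHS]mulrC; apply: ler_wpM2l; first exact: exprn_ge0.
  apply: (@le_trans _ _ ((4 * d)%:R * (L.+1%:R * q ^+ L))).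
    rewrite mulrA -natrM; apply: ler_wpM2r; first exact: exprn_ge0.
    by rewrite ler_nat; nia.
  by rewrite ler_pM2l// ltr0n muln_gt0.
have b0 : 0 <= (2 * (d * (2 * L))).+1%:R * q ^+ (2 * L) :> R.
  by rewrite mulr_ge0 ?exprn_ge0.
apply: le_trans (_ : _ <= (2 * (d * (2 * L))).+1%:R * q ^+ (2 * L)) (le_trans h he).
rewrite -[leRHS]expr1; apply: ler_wiXn2l => //; exact: le_trans h h1.
Qed.

(** The kernel also peaks at differences 1 and -1; a margin [dl] between [x] and the faces keeps
    away from these peaks. *)
Lemma cube_far_dist x y (dl : R) (j : 'I_d) : cube y ->
  dl <= x ord0 j <= 1 - dl -> dl <= `|x ord0 j - y ord0 j| ->
  dl <= `|x ord0 j - y ord0 j| <= 1 - dl.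
Proof.
move=> /(_ j) yj xj -> /=; rewrite ler_norml; lra.
Qed.

Lemma integrable_cst_tcube (c : R) : mu.-integrable D (EFin \o (fun=> c)).
Proof.
apply: measurable_bounded_integrable; first exact: measurable_tcube.
- by rewrite [X in (X < _)%E]lebesgue_tcube ltry.
- exact: measurable_cst.
- by exists `|c|; split => // M M1 t _ /=; exact: ltW.
Qed.

Lemma measurable_kernel N x (A : set (d.-tuple (measurableTypeR R))) :
  measurable_fun A (fun t => kernel N (x - row t)).
Proof.
apply: measurable_funTS.
rewrite (_ : (fun t => _) = (fun t : d.-tuple (measurableTypeR R) =>
    \prod_(j < d) (fun (i : 'I_d) (s : R) => kernel1 N (x ord0 i - s)) j (tnth t j))).
  apply: (@measurable_prod_tnth R d (fun (i : 'I_d) (s : R) => kernel1 N (x ord0 i - s))).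
  by move=> i; exact: measurable_kernel1.
by apply/funext => t; apply: eq_bigr => j _; rewrite !mxE.
Qed.

Lemma integrable_mul_kernel N x (g : d.-tuple (measurableTypeR R) -> R) :
  mu.-integrable D (EFin \o g) ->
  mu.-integrable D (EFin \o (fun t => g t * kernel N (x - row t))).
Proof.
move=> ig; rewrite (_ : EFin \o _ = ((EFin \o (fun t => kernel N (x - row t))) \*
  (EFin \o g))%E); last by apply/funext => t /=; rewrite mulrC.
apply: integrableMr => //; first exact: measurable_tcube.
  exact: measurable_kernel.
exists ((2 * N).+1%:R ^+ d); split=> [//|M M1 t _ /=]; apply: le_trans (ltW M1).
rewrite ger0_norm ?kernel_ge0//.
have -> : (2 * N).+1%:R ^+ d = \prod_(j < d) (2 * N).+1%:R :> R.
  by rewrite prodr_const card_ord.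
apply: ler_prod => j _; rewrite kernel1_ge0/=; set s := x - row t.
have := @kernel1_le R N (s ord0 j) 1; rewrite expr1n mulr1; apply.
have := sqr_ge0 (sin (pi * s ord0 j)); have := cos2Dsin2 (pi * s ord0 j); lra.
Qed.

(** As the kernel has mean 1, the error is the integral of [f - f x] against it. Near [x] continuity
    applies; elsewhere the kernel is uniformly small and multiplies the L1 norm of [f - f x], which
    is finite even if [f] is unbounded. *)
Lemma smoothing_cvg f x (e : R) : (0 < d)%N -> {within @cube R d, continuous f} ->
  cube_integrable f -> (forall j, 0 < x ord0 j < 1) -> 0 < e ->
  \forall L \near \oo, `|f x - smoothing (d * (2 * L)) f x| <= e.
Proof.
move=> d0 cf intf x01 e0; have mD := @measurable_tcube R d.
have cx : cube x by move=> j; have /andP[/ltW -> ->] := x01 j.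
have e2 : 0 < e / 2 by lra.
have /subspace_continuousP /(_ x cx) /cvgrPdist_le /(_ _ e2) := cf.
rewrite /prop_near1/= /within/= -/(prop_near1 _) => /nbhs_ballP[d1 /= d10 Hd1].
have [dl [dl0 dld1 dlx]] : exists dl : R, [/\ 0 < dl, dl <= d1 &
    forall j, dl <= x ord0 j <= 1 - dl].
  have : \forall dl \near (0 : R)^'+, [/\ 0 < dl, dl <= d1 &
      forall j, dl <= x ord0 j <= 1 - dl].
    have H : \forall dl \near (0 : R)^'+, forall j, dl <= x ord0 j <= 1 - dl.
      apply: filter_forall => j; have /andP[xj0 xj1] := x01 j.
      have h : 0 < 1 - x ord0 j by lra.
      near=> s; apply/andP; split.
        by near: s; exact: nbhs_right_le.
      suff : s <= 1 - x ord0 j by lra.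
      by near: s; exact: nbhs_right_le.
    near=> s; split.
    - by near: s; exact: nbhs_right_gt.
    - by near: s; exact: nbhs_right_le.
    - by near: s.
  by move=> /filter_ex[dl ?]; exists dl.
have q01 : 0 <= cos (pi * dl) ^+ 2 < 1.
  rewrite sqr_ge0/= cos_sqr_lt1// dl0/=.
  by have := dlx (Ordinal d0); lra.
pose g t := f (row t) - f x.
have ig : mu.-integrable D (EFin \o g).
  rewrite (_ : EFin \o g = ((EFin \o (f \o row)) \- (EFin \o (fun=> f x)))%E).
    by apply: integrableB => //; exact: integrable_cst_tcube.
  by apply/funext => t.
have iag : mu.-integrable D (EFin \o (fun t => `|g t|)).
  exact: integrable_abse ig.
pose G := \int[mu]_(t in D) `|g t|.
have G0 : 0 <= G by exact: Rintegral_ge0.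
(* This threshold makes the far part at most [e / 2]; adding 1 guards against [G = 0]. *)
have := @kernel_tail_small _ (e / 2 / (G + 1)) d0 q01.
case; first by rewrite divr_gt0//; lra.
move=> L0 _ HL; exists L0 => // L /= LL.
have {HL} := HL L LL; set N := (d * (2 * L))%N.
set s := _ * _ => sle.
have s0 : 0 <= s.
  apply: mulr_ge0; first exact: exprn_ge0.
  by apply: exprn_ge0; exact: sqr_ge0.
have iK : mu.-integrable D (EFin \o (fun t => kernel N (x - row t))).
  rewrite (_ : (fun t => _) = (fun t => 1 * kernel N (x - row t))).
    exact: integrable_mul_kernel (integrable_cst_tcube 1).
  by apply/funext => t; rewrite mul1r.
have IK : \int[mu]_(t in D) kernel N (x - row t) = 1.
  by rewrite /Rintegral integral_kernel.
have igK := @integrable_mul_kernel N x _ ig.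
have -> : f x - smoothing N f x = - \int[mu]_(t in D) (g t * kernel N (x - row t)).
  apply/eqP; rewrite -subr_eq0 opprK addrAC subr_eq0; apply/eqP.
  rewrite -[X in X + _]mulr1 -IK -RintegralZl// -RintegralD//.
    by apply: eq_Rintegral => t _; rewrite /g; ring.
  exact: (integrableZl mD _ iK).
rewrite normrN; apply: (le_trans (le_normr_Rintegral _ _)) => //.
(* The sum of the near and far bounds dominates pointwise everywhere, so the cube need not be
   split. *)
apply: (@le_trans _ _ (\int[mu]_(t in D) (e / 2 * kernel N (x - row t) + s * `|g t|))).
  apply: le_Rintegral => //.
  - exact: integrable_abse igK.
  - rewrite (_ : EFin \o _ = ((fun t => (e / 2)%:E * (EFin \o (fun t => kernel N (x - row t))) t) \+
      (fun t => s%:E * (EFin \o (fun t => `|g t|%R)) t))%E).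
      by apply: integrableD => //; exact: integrableZl.
    by apply/funext => t.
  - move=> t Dt /=; rewrite normrM (ger0_norm (kernel_ge0 _ _)).
    have K0 := kernel_ge0 N (x - row t).
    have [/forallP near_x|] := boolP [forall j, `|x ord0 j - row t ord0 j| < dl].
      apply: (@le_trans _ _ (e / 2 * kernel N (x - row t))).
        apply: ler_wpM2r => //; rewrite /g distrC; apply: Hd1 => //.
        split => // i j; rewrite ord1 /ball/=; exact: lt_le_trans (near_x j) dld1.
      by rewrite lerDl mulr_ge0.
    rewrite negb_forall => /existsP[j]; rewrite -leNgt => far.
    apply: (@le_trans _ _ (s * `|g t|)); last by rewrite lerDr mulr_ge0// ltW.
    rewrite mulrC; apply: ler_wpM2r => //; apply: (@kernel_le _ j).
    rewrite !mxE -[X in _ + - X]/(tnth t j) in far *.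
    apply: cos_sqr_le; first exact: ltW.
    have := @cube_far_dist x (row t) dl j Dt (dlx j).
    by rewrite mxE; apply.
rewrite RintegralD//; last 2 first.
- exact: (integrableZl mD _ iK).
- exact: (integrableZl mD _ iag).
rewrite !RintegralZl// IK mulr1 -/G.
have : s * G <= e / 2 / (G + 1) * G by exact: ler_wpM2r.
have : e / 2 / (G + 1) * G <= e / 2.
  by rewrite -mulrA ler_piMr ?(ltW e2)// mulrC ler_pdivrMr ?mul1r; lra.
lra.
Unshelve. all: by end_near. Qed.

End convergence.

(** * The error of the equal-weight rule *)

Section error_bound.
Context {R : realType} {d : nat}.
Implicit Types (f : 'rV[R]_d -> R) (k : 'rV[int]_d).

Lemma phase0 (x : 'rV[R]_d) : phase 0 x = 0.
Proof. by rewrite /phase big1 ?mulr0// => j _; rewrite mxE mulr0z mul0r. Qed.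

(** Frequency 0 reproduces the integral exactly. Every other one contributes at most [eps] times its
    term in [wnorm], half from the cosine and half from the sine, as the kernel coefficients lie in
    [0, 1]. *)
Lemma smoothing_error n (x : 'I_n -> 'rV[R]_d) (r : 'rV[int]_d -> R) (eps : R) f N :
  (0 < n)%N -> 0 <= eps -> (forall k, 0 <= r k) ->
  (forall k, k != 0 ->
      `|\sum_h cos (phase k (x h))| <= n%:R * (eps / 2 * r k) /\
      `|\sum_h sin (phase k (x h))| <= n%:R * (eps / 2 * r k)) ->
  cube_integrable f -> (wnorm r f <= 1)%E ->
  `|cube_integral f - \sum_(h < n) n%:R^-1 * smoothing N f (x h)| <= eps.
Proof.
move=> n0 e0 r0 Hx intf wf.
have n0' : 0 < n%:R :> R by rewrite ltr0n.
pose nc k := ComplexField.Normc.normc (fourier_coef f k).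
pose T (a : {ffun 'I_d -> 'I_(2 * N).+1}) : R := (\prod_(j < d) kcoef N (a j)) *
    (fcos f (boxfreq a) * (n%:R^-1 * \sum_h cos (phase (boxfreq a) (x h))) +
     fsin f (boxfreq a) * (n%:R^-1 * \sum_h sin (phase (boxfreq a) (x h)))).
have -> : \sum_(h < n) n%:R^-1 * smoothing N f (x h) = \sum_a T a.
  under eq_bigr do rewrite smoothingE// mulr_sumr.
  rewrite exchange_big; apply: eq_bigr => a _; rewrite /T !mulrA !mulr_sumr -big_split/=.
  by rewrite mulr_sumr; apply: eq_bigr => h _; ring.
have NN : (N < (2 * N).+1)%N by lia.
(* The constant index [N] encodes the frequency 0. *)
pose a0 : {ffun 'I_d -> 'I_(2 * N).+1} := [ffun=> Ordinal NN].
have a00 : boxfreq a0 = 0 by apply/rowP => j; rewrite !mxE ffunE subrr.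
have Ta0 : T a0 = cube_integral f.
  rewrite /T a00 big1 ?mul1r; last by move=> j _; rewrite ffunE/= kcoef_central.
  rewrite [X in _ + fsin f 0 * (_ * X)]big1; last first.
    by move=> h _; rewrite phase0 sin0.
  rewrite !mulr0 addr0 (eq_bigr (fun=> 1)); last by move=> h _; rewrite phase0 cos0.
  rewrite sumr_const card_ord mulVf ?gt_eqF// mulr1.
  by apply: eq_Rintegral => t _; rewrite phase0 cos0 mulr1.
rewrite (bigD1 a0)//= Ta0 opprD addNKr normrN.
apply: (le_trans (ler_norm_sum _ _ _)).
apply: (@le_trans _ _ (\sum_a eps * (nc (boxfreq a) * r (boxfreq a)))).
  rewrite [leRHS](bigD1 a0)//=; apply: le_trans (_ : _ <= \sum_(i | i != a0)
    eps * (nc (boxfreq i) * r (boxfreq i))) _; last first.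
    by rewrite lerDr !mulr_ge0//; exact: sqrtr_ge0.
  apply: ler_sum => a aa0.
  have a0' : boxfreq a != 0.
    by apply: contra aa0 => /eqP; rewrite -a00 => /boxfreq_inj ->.
  have [hc hs] := Hx _ a0'.
  have avg (S : R) : `|S| <= n%:R * (eps / 2 * r (boxfreq a)) ->
      `|n%:R^-1 * S| <= eps / 2 * r (boxfreq a).
    by move=> hS; rewrite normrM ger0_norm ?invr_ge0// [leLHS]mulrC ler_pdivrMr// [leRHS]mulrC.
  have c0 : 0 <= \prod_(j < d) kcoef (R := R) N (a j).
    by apply: prodr_ge0 => j _; exact: kcoef_ge0.
  have c1 : \prod_(j < d) kcoef (R := R) N (a j) <= 1.
    by apply: prodr_ile1 => j _; rewrite kcoef_ge0 kcoef_le1.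
  rewrite /T normrM (ger0_norm c0) -[leRHS]mul1r.
  apply: ler_pM => //; apply: (le_trans (ler_normD _ _)); rewrite !normrM.
  have -> : eps * (nc (boxfreq a) * r (boxfreq a)) =
    nc (boxfreq a) * (eps / 2 * r (boxfreq a)) + nc (boxfreq a) * (eps / 2 * r (boxfreq a)).
    by field.
  rewrite -!(normrM n%:R^-1).
  by apply: lerD; apply: ler_pM => //; [exact: fcos_le|exact: avg|exact: fsin_le|exact: avg].
rewrite -mulr_sumr -[leRHS]mulr1; apply: ler_wpM2l => //.
rewrite -lee_fin; exact: le_trans (sum_boxfreq_wnorm f N r0) wf.
Qed.

(** The bound for the smoothed function does not depend on its degree. One degree serves all [n]
    points up to [e], and the weights sum to 1, so the total loss is at most [e]. *)
Lemma error_le n (x : 'I_n -> 'rV[R]_d) (r : 'rV[int]_d -> R) (eps : R) f :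
  (0 < d)%N -> (0 < n)%N -> 0 <= eps -> (forall k, 0 <= r k) ->
  (forall h j, 0 < x h ord0 j < 1) ->
  (forall k, k != 0 ->
      `|\sum_h cos (phase k (x h))| <= n%:R * (eps / 2 * r k) /\
      `|\sum_h sin (phase k (x h))| <= n%:R * (eps / 2 * r k)) ->
  F_space r f -> (wnorm r f <= 1)%E ->
  `|cube_integral f - linear_algorithm (fun=> n%:R^-1) x f| <= eps.
Proof.
move=> d0 n0 e0 r0 x01 Hx [cf intf _] wf; apply/ler_addgt0Pr => e ep.
have [L HL] : exists L, forall h, `|f (x h) - smoothing (d * (2 * L)) f (x h)| <= e.
  have : \forall L \near \oo, forall h, `|f (x h) - smoothing (d * (2 * L)) f (x h)| <= e.
    by apply: filter_forall => h; exact: smoothing_cvg.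
  by move=> /filter_ex[L HL]; exists L.
set N := (d * (2 * L))%N in HL.
rewrite -(subrK (\sum_(h < n) n%:R^-1 * smoothing N f (x h)) (cube_integral f)) -addrA.
apply: (le_trans (ler_normD _ _)); apply: lerD; first exact: (@smoothing_error _ _ r).
rewrite /linear_algorithm -sumrB; apply: (le_trans (ler_norm_sum _ _ _)).
apply: (@le_trans _ _ (\sum_(h < n) n%:R^-1 * e)).
  apply: ler_sum => h _; rewrite -mulrBr normrM ger0_norm ?invr_ge0//.
  by rewrite ler_wpM2l ?invr_ge0// distrC.
by rewrite sumr_const card_ord -[leLHS]mulr_natl mulrA mulfV ?mul1r// gt_eqF// ltr0n.
Qed.

End error_bound.

(** * The number of points *)

Theorem theorem4 (R : realType) :
  exists C : R, 0 < C /\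
    forall (d : nat) (eps : R), (0 < d)%N -> 0 < eps < 1 ->
      (n_wor eps (@r4 R d) <=
         (C * (d%:R / eps ^+ 2) * ln (1 + 1 / eps))%:E)%E.
Proof.
have ln20 : 0 < ln 2 :> R by rewrite ln_gt0// ltr1n.
(* 225 is 224 plus 1 for rounding up, as [B >= 1]; dividing by [ln 2] pays for the logarithm, which
   is at least [ln 2]. *)
exists (225 / ln 2); split; first by rewrite divr_gt0.
move=> d eps d0 e01; have /andP[e0 e1] := e01.
pose B : R := d%:R / eps ^+ 2.
have B1 : 1 <= B.
  rewrite ler_pdivlMr ?exprn_gt0// mul1r (@le_trans _ _ 1) ?ler1n//.
  by rewrite exprn_ile1// ltW.
pose n := (Num.truncn (224 * B)).+1.
have nlo : 224 * B <= n%:R by apply/ltW/truncnS_gt.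
have nhi : n%:R <= 225 * B.
  have : (Num.truncn (224 * B))%:R <= 224 * B by rewrite truncn_le //; lra.
  rewrite /n -(natr1 (Num.truncn _)); lra.
have [x [x01 Hx]] := qmc_points d0 e01 nlo.
apply: (@le_trans _ _ n%:R%:E).
  apply: ereal_inf_lbound; exists n => //; exists (fun=> n%:R^-1), x; split.
    by move=> h j; have /andP[/ltW -> ->] := x01 h j.
  apply: ge_ereal_sup => _ [f [Ff wf] <-]; rewrite lee_fin.
  apply: (@error_le _ _ _ _ (@r4 R d)) => //; first exact: ltW.
  by move=> k; rewrite (le_trans ler01)// r4_ge1.
rewrite lee_fin; apply: (le_trans nhi); rewrite -/B.
have : ln 2 <= ln (1 + 1 / eps).
  rewrite ler_ln ?posrE//; last by rewrite addr_gt0// divr_gt0.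
  by have : 1 <= 1 / eps; [rewrite ler_pdivlMr// mul1r ltW|lra].
move=> hl; have -> : 225 * B = 225 / ln 2 * B * ln 2 by field; rewrite gt_eqF.
apply: ler_wpM2l => //; apply: mulr_ge0; last exact: le_trans B1.
by rewrite divr_ge0// ltW.
Qed.
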